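(* Let $n\ge 2$ with $n\equiv 1\pmod 4$ be fixed. For $\Delta\ge 1$ let $Q_n(\Delta)$ be the number of distinct quadratic fields $\mathbb{Q}(\sqrt{\Delta_n(a,b)})$ taken over all integers $a,b\ge 1$ such that $X^n+aX+b$ is irreducible over $\mathbb{Q}$ and $|\Delta_n(a,b)|\le\Delta$. Then $$Q_n(\Delta)\ge\Delta^{1/(n-1)+o(1)}.$$
   Context: For integers $a,b$, $\Delta_n(a,b)=(n-1)^{n-1}a^n+n^nb^{n-1}$ (for $n\equiv 1\pmod 4$ this is the discriminant of the trinomial $X^n+aX+b$). $o(1)$ denotes a quantity that tends to $0$ as $\Delta\to\infty$ for fixed $n$. *)

(* Defs.v *)
From HB Require Import structures.
From mathcomp Require Import all_boot all_order all_algebra all_field finmap.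
From mathcomp Require Import all_classical all_reals all_analysis.

Set Implicit Arguments.
Unset Strict Implicit.
Unset Printing Implicit Defensive.

Import Order.TTheory GRing.Theory Num.Theory.
Import numFieldNormedType.Exports.

Local Open Scope classical_set_scope.
Local Open Scope ring_scope.

Definition trinom_disc (n : nat) (a b : int) : int :=
  n.-1%:Z ^+ n.-1 * a ^+ n + n%:Z ^+ n * b ^+ n.-1.

Definition trinom (n : nat) (a b : int) : {poly rat} :=
  'X^n + (a%:~R)%:P * 'X + (b%:~R)%:P.

(* Number fields are taken inside algC, as sets of algebraic numbers; a subset *)
(* of algC containing 1 and closed under subtraction and division (where       *)
(* x / 0 = 0) is exactly a subfield.                                           *)
Definition is_subfield (K : set algC) : Prop := divring_closed [in K].

Definition Qadjoin (z : algC) : set algC := smallest is_subfield [set z].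

Definition is_quadratic (K : set algC) : Prop :=
  is_subfield K /\
  exists x y : algC,
    [/\ K = [set ratr u * x + ratr v * y | u in [set: rat] & v in [set: rat]]
      & forall u v : rat, ratr u * x + ratr v * y = 0 -> u = 0 /\ v = 0].

(* Two quadratic fields are isomorphic iff they are equal as subfields of      *)
(* algC, so "distinct" may be read as set equality. The condition is_quadratic *)
(* discards the pairs (a, b) for which the discriminant is a perfect square.   *)
Definition disc_fields (R : realType) (n : nat) (D : R) : set (set algC) :=
  [set K | is_quadratic K /\
     exists a b : int,
       [/\ 1 <= a, 1 <= b, irreducible_poly (trinom n a b),
           `|trinom_disc n a b|%:~R <= D
         & K = Qadjoin (sqrtC (trinom_disc n a b)%:~R)]].

(* For 2 <= n the set is finite, because a, b <= trinom_disc n a b whenever    *)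
(* 1 <= a and 1 <= b; so fset_set does not fall back to its default value.     *)
Definition Qcount (R : realType) (n : nat) (D : R) : nat :=
  #|` fset_set (disc_fields n D)|%fset.

(* Main.v *)
Require Import Defs.
From HB Require Import structures.
From mathcomp Require Import all_boot all_order all_algebra all_field finmap.
From mathcomp Require Import all_classical all_reals all_analysis.
From mathcomp Require Import ring zify.
Import Order.TTheory GRing.Theory Num.Theory.
Import numFieldNormedType.Exports.
Local Open Scope classical_set_scope.
Local Open Scope ring_scope.

(** Write m = n - 1, which is even. On the pairs a = n t, b = t c the
discriminant factors as

    m^m (n t)^n + n^n (t c)^m = n^n t^m N,    N = m^m t + c^m,

and n^n t^m is n times a square, so the field is Q(sqrt(n N)): t enters the
square class only through N, in which it is linear.

Put L = 4 m^m. Every N = 1 + 2 m^m mod L is of the form m^m t + c^m with t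
small: take for c the largest integer such that c = 1 mod L and c^m <= N.
Then t is at most a constant times c^(m-1), because consecutive candidates for
c differ by L, and therefore n^n t^m N <= C N^m for some C depending on n only
([progression_decomp]). The residue of N forces t = 2 mod 4 with c odd, so that
a is even and b is exactly divisible by 2: the trinomial is irreducible by
Eisenstein's criterion at 2 ([irreducible_trinom]).

Hence each N <= (D / C)^(1/m) in this residue class contributes the field
Q(sqrt(n N)). Restricting to squarefree N loses at most a fixed proportion:
such N are prime to L, so only the multiples of d^2 with d >= 3 have to be
discarded, and the sum of 1 / d^2 over d >= 3 is below 1/2
([count_squarefree]). For distinct squarefree N > n the numbers n N lie in
distinct nontrivial square classes, so the fields are quadratic and pairwise
distinct ([mul_squarefree_nsqr], [twisted_field_inj]).

This yields at least delta D^(1/m) fields for a constant delta > 0 and large D,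
a bound stronger than the one claimed; the error exponent is
ln delta / ln D. *)

(** * Quadratic fields as sets of algebraic numbers *)

Definition quad_span (z : algC) : set algC :=
  [set ratr u * 1 + ratr v * z | u in [set: rat] & v in [set: rat]].

Lemma quad_spanP (z x : algC) :
  quad_span z x <-> exists u v : rat, x = ratr u + ratr v * z.
Proof.
split=> [[u _ [v _ <-]]|[u [v ->]]]; first by exists u, v; rewrite mulr1.
by exists u => //; exists v => //; rewrite mulr1.
Qed.

Lemma subfield_rat (K : set algC) (u : rat) : is_subfield K -> K (ratr u).
Proof.
case; rewrite in_setE => K1 KB KV.
have BK x y : K x -> K y -> K (x - y).
  by move=> Kx Ky; rewrite -in_setE; apply: KB; rewrite in_setE.
have VK x y : K x -> K y -> K (x / y).
  by move=> Kx Ky; rewrite -in_setE; apply: KV; rewrite in_setE.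
have K0 : K 0 by rewrite -(subrr 1); apply: BK.
have Knat (k : nat) : K k%:R.
  elim: k => [|k IH] //.
  have -> : k.+1%:R = k%:R - (0 - 1) :> algC by rewrite sub0r opprK -natr1.
  by apply: (BK) => //; apply: (BK).
have Kint (k : int) : K k%:~R.
  case: k => k; first exact: Knat.
  by rewrite NegzE mulrNz -sub0r; apply: (BK) => //; apply: Knat.
by rewrite /ratr; apply: (VK); apply: Kint.
Qed.

(** Quotients are computed by multiplying with the conjugate. The number [e] may
be a square, in which case the norm of a nonzero element of the span can be
zero; that case has to be treated apart. *)
Lemma subfield_quad_span (z : algC) (e : rat) :
  z ^+ 2 = ratr e -> is_subfield (quad_span z).
Proof.
move=> z2; split.
- rewrite in_setE quad_spanP; exists 1, 0.
  by rewrite rmorph1 rmorph0 mul0r addr0.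
- move=> x y; rewrite !in_setE !quad_spanP => -[u [v ->]] [u' [v' ->]].
  by exists (u - u'), (v - v'); rewrite !rmorphB /=; ring.
- move=> x y; rewrite !in_setE !quad_spanP => -[u [v ->]] [u' [v' ->]].
  have [Y0|Y0] := eqVneq (ratr u' + ratr v' * z) 0.
    by exists 0, 0; rewrite Y0 invr0 mulr0 rmorph0 mul0r addr0.
  (* If u' = v' z then the denominator is 2 u', a rational number. *)
  have [C0|C0] := eqVneq (ratr u' - ratr v' * z) 0.
    have E : ratr u' = ratr v' * z by apply/eqP; rewrite -subr_eq0 C0.
    have U0 : ratr u' != 0 :> algC.
      by apply: contraNneq Y0 => U0; rewrite -E U0 addr0.
    exists (u / (u' *+ 2)), (v / (u' *+ 2)).
    rewrite -E !rmorphM /= !fmorphV /= !rmorphMn /=.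
    have U2 : ratr u' + ratr u' != 0 :> algC by rewrite -mulr2n mulrn_eq0.
    rewrite mulr2n; field; exact: U2.
  set d := u' ^+ 2 - v' ^+ 2 * e.
  have dE : ratr d = (ratr u' + ratr v' * z) * (ratr u' - ratr v' * z).
    by rewrite /d rmorphB !rmorphM /= -z2; ring.
  clearbody d; exists ((u * u' - v * v' * e) / d), ((v * u' - u * v') / d).
  rewrite !rmorphM /= !fmorphV /= !rmorphB /= dE !rmorphM /= -z2.
  by field; rewrite Y0 C0.
Qed.

Lemma QadjoinE (z : algC) (e : rat) :
  z ^+ 2 = ratr e -> Qadjoin z = quad_span z.
Proof.
move=> z2; apply/seteqP; split.
  apply: smallest_sub; first exact: subfield_quad_span z2.
  move=> _ ->; apply/quad_spanP; exists 0, 1.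
  by rewrite rmorph0 rmorph1 mul1r add0r.
move=> x /quad_spanP[u [v ->]] K [KK /(_ z erefl) Kz].
have := KK; case; rewrite in_setE => K1 KB KV.
have Ku := subfield_rat K u KK; have Kv := subfield_rat K (- v^-1) KK.
have [->|v0] := eqVneq v 0; first by rewrite rmorph0 mul0r addr0.
have -> : ratr u + ratr v * z = ratr u - z / ratr (- v^-1).
  by rewrite rmorphN fmorphV /= invrN invrK mulrN opprK mulrC.
rewrite -in_setE; apply: KB; rewrite ?in_setE //.
by rewrite -in_setE; apply: KV; rewrite ?in_setE.
Qed.

Lemma sqrt_indep (z : algC) (e u v : rat) : z ^+ 2 = ratr e ->
  (forall w, w ^+ 2 <> e) -> ratr u + ratr v * z = 0 -> u = 0 /\ v = 0.
Proof.
move=> z2 nsq E; have [v0|v0] := eqVneq v 0.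
  by move/eqP: E; rewrite v0 rmorph0 mul0r addr0 fmorph_eq0 => /eqP->.
case: (nsq (u / v)); apply: (fmorph_inj (@ratr algC)).
have V0 : ratr v != 0 :> algC by rewrite fmorph_eq0.
have zE : z = - (ratr u / ratr v).
  apply: (mulfI V0); rewrite mulrN mulrCA divff // mulr1.
  by apply/eqP; rewrite -addr_eq0 addrC E.
by rewrite rmorphXn rmorphM fmorphV /= -z2 zE sqrrN.
Qed.

Lemma Qadjoin_quadratic (z : algC) (e : rat) : z ^+ 2 = ratr e ->
  (forall w, w ^+ 2 <> e) -> is_quadratic (Qadjoin z).
Proof.
move=> z2 nsq; rewrite (QadjoinE z e z2); split.
  exact: subfield_quad_span z2.
exists 1, z; split=> // u v; rewrite mulr1; exact: (sqrt_indep z e u v).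
Qed.

(** Two quadratic fields coincide only if their radicands agree up to squares.
Write [z = u + v * z'] and square: the coefficient [2 * u * v] of [z'] vanishes
as soon as [z'] is irrational, and [v = 0] would make [e] a square, so that
[u = 0] and [e = v ^+ 2 * e']. *)
Lemma Qadjoin_eq_sqr (z z' : algC) (e e' : rat) :
  z ^+ 2 = ratr e -> z' ^+ 2 = ratr e' -> (forall w, w ^+ 2 <> e) ->
  Qadjoin z = Qadjoin z' -> exists w : rat, w ^+ 2 = e * e'.
Proof.
move=> z2 z2' nsq.
rewrite (QadjoinE z e z2) (QadjoinE z' e' z2') => Kz.
have /quad_spanP[u [v zE]] : quad_span z' z.
  rewrite -Kz; apply/quad_spanP; exists 0, 1.
  by rewrite rmorph0 rmorph1 mul1r add0r.
have E0 : ratr (u ^+ 2 - e + v ^+ 2 * e') + ratr (u * v *+ 2 ) * z' = 0.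
  by rewrite rmorphMn rmorphD rmorphB !rmorphM /= -z2 -z2' zE; ring.
have [U0|U0] := eqVneq u 0.
  exists (v * e'); apply: (fmorph_inj (@ratr algC)).
  rewrite rmorphXn !rmorphM /= -z2 -z2' zE U0 rmorph0; ring.
have [V0|V0] := eqVneq v 0.
  case: (nsq u); apply: (fmorph_inj (@ratr algC)).
  by rewrite rmorphXn /= -z2 zE V0 rmorph0 mul0r addr0.
have [nsq'|/existsNP[w /contrapT w2]] := pselect (forall w, w ^+ 2 <> e').
  have [_ /eqP] := sqrt_indep z' e' _ _ z2' nsq' E0.
  by rewrite mulrn_eq0 mulf_eq0 (negPf U0) (negPf V0).
(* If e' is a square, then z' and hence z are rational. *)
have [s z'E] : exists s : rat, z' = ratr s.
  have : (z' - ratr w) * (z' + ratr w) = 0.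
    by rewrite -subr_sqr z2' -w2 rmorphXn subrr.
  move/eqP; rewrite mulf_eq0 subr_eq0 addr_eq0 => /orP[/eqP->|/eqP->].
    by exists w.
  by exists (- w); rewrite rmorphN.
case: (nsq (u + v * s)); apply: (fmorph_inj (@ratr algC)).
by rewrite rmorphXn rmorphD rmorphM /= -z2 zE z'E.
Qed.

(** * Irreducible trinomials *)

(** Irreducibility of an integer polynomial concerns divisors with integer
coefficients and pseudo-division, that is divisibility over the fraction field;
a rational divisor reaches this setting once its denominators are cleared. *)
Lemma irreducible_int_rat (q : {poly int}) :
  irreducible_poly q -> irreducible_poly (map_poly (intr : int -> rat) q).
Proof.
move=> [q1 qI]; split.
  by rewrite size_map_inj_poly //; exact: intr_inj.
move=> d d1 dq; have [d' [c c0 dE]] := rat_poly_scale d.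
have c0' : (c%:~R : rat)^-1 != 0 by rewrite invr_eq0 intr_eq0.
have dd' : d %= map_poly (intr : int -> rat) d' by rewrite dE eqp_scale.
have d'1 : size d' != 1%N.
  by move: d1; rewrite (eqp_size dd') size_map_inj_poly //; exact: intr_inj.
have d'q : d' %| q by rewrite -dvdp_rat_int -(eqp_dvdl _ dd').
have /andP[_ qd'] := qI d' d'1 d'q.
by rewrite (eqp_trans dd') // /eqp !dvdp_rat_int d'q.
Qed.

Lemma irreducible_trinom (p n : nat) (a b : int) : prime p -> (2 <= n)%N ->
  (p %| a)%Z -> (p %| b)%Z -> ~~ (p ^+ 2 %| b)%Z ->
  irreducible_poly (trinom n a b).
Proof.
move=> p_pr n2 pa pb p2b.
pose r : {poly int} := a%:P * 'X + b%:P.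
have sr : (size r <= 2)%N.
  by rewrite size_MXaddC; case: ifP => // _; rewrite ltnS size_polyC_leq1.
have sr' : (size r < size ('X^n : {poly int}))%N.
  by rewrite size_polyXn ltnS (leq_trans sr).
have r0 : r`_0 = b by rewrite coefD coefMX /= coefC add0r.
have -> : trinom n a b = map_poly intr ('X^n + r).
  rewrite /trinom rmorphD /= rmorphD rmorphM /=.
  by rewrite map_polyXn map_polyX !map_polyC addrA.
apply: irreducible_int_rat; apply: (eisenstein_crit p_pr).
- by rewrite size_polyDl // size_polyXn eqSS -lt0n ltnW.
- rewrite lead_coefDl // lead_coefXn dvdz1.
  by case: p p_pr {pa pb p2b} => [|[|p]].
- by rewrite coefD coefXn r0; case: (n) n2 => // k _; rewrite add0r.
move=> i; rewrite size_polyDl // size_polyXn /= => iN.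
rewrite coefD coefXn (ltn_eqF iN) add0r coefD coefMX !coefC.
by case: i iN => [|[|i]] _; rewrite /= ?add0r ?addr0 ?dvdz0.
Qed.

(** * Representing a residue class by m^m t + c^m *)

Lemma leq_wexp2r (e x y : nat) : (x <= y)%N -> (x ^ e <= y ^ e)%N.
Proof. by case: e => [|e] // xy; rewrite leq_exp2r. Qed.

Definition modulus (m : nat) : nat := 4 * m ^ m.
(** The residue [1 + 2 * m ^ m] is chosen so that subtracting an [m]-th power
that is 1 modulo [modulus m] leaves [m ^ m * t] with [t = 2 %[mod 4]]. *)
Definition progression (m k : nat) : nat := 1 + 2 * m ^ m + k * modulus m.

(** A mean value inequality: the derivative of [x ^ m] is largest at the right
end of the interval. *)
Lemma expn_leq_secant (x y m : nat) :
  ((x + y) ^ m <= x ^ m + m * y * (x + y) ^ m.-1)%N.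
Proof.
case: m => [|m] //=; elim: m => [|m IH]; first by rewrite !expn1 expn0; lia.
have H : (x * x ^ m.+1 <= (x + y) * x ^ m.+1)%N.
  by rewrite leq_mul2r leq_addr orbT.
rewrite [in leqLHS]expnS mulnDl.
have /(leq_mul (leqnn x)) := IH.
rewrite mulnDr -expnS => {}IH.
have : (x * (m.+1 * y * (x + y) ^ m) <= m.+1 * y * (x + y) ^ m.+1)%N.
  by rewrite [in leqRHS]expnS mulnCA leq_mul2l leq_mul2r leq_addr !orbT.
nia.
Qed.

Lemma expn_1mod (L j m : nat) : exists q, ((1 + L * j) ^ m = 1 + L * q)%N.
Proof.
elim: m => [|m [q IH]]; first by exists 0%N; rewrite muln0.
by exists (j + q + L * j * q)%N; rewrite expnS IH; ring.
Qed.

(** The gap between consecutive [m]-th powers of integers that are 1 modulo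
[modulus m] is at most the base of this power times [c ^ m.-1]. *)
Definition height_const (m : nat) : nat :=
  (m * modulus m * (1 + modulus m) ^ m.-1) ^ m.

(** Take for [c] the largest integer that is 1 modulo [L] and has [c ^ m <= N].
The next candidate [c + L] overshoots, hence
[t <= (c + L) ^ m - c ^ m <= A * c ^ m.-1] with [A = m * L * (1 + L) ^ m.-1]
(using [c + L <= (1 + L) * c]), and raising this to the power [m] gives
[t ^ m * N <= A ^ m * (c ^ m) ^ m.-1 * N <= A ^ m * N ^ m]. The bound is thus of
order [N ^ m] although [t] itself has size about [N ^ (1 - 1 / m)]. *)
Lemma progression_decomp (m k : nat) : (0 < m)%N ->
  exists t c : nat,
    [/\ progression m k = (m ^ m * t + c ^ m)%N, (t = 2 %[mod 4])%N, odd c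
      & (t ^ m * progression m k <= height_const m * progression m k ^ m)%N].
Proof.
move=> m0; set N := progression m k; set L := modulus m.
have M0 : (0 < m ^ m)%N by rewrite expn_gt0 m0.
have L0 : (0 < L)%N by rewrite /L /modulus; lia.
have P0 : exists j, ((1 + L * j) ^ m <= N)%N.
  by exists 0%N; rewrite muln0 addn0 exp1n /N /progression; lia.
have Pb j : ((1 + L * j) ^ m <= N)%N -> (j <= N)%N.
  apply: leq_trans; apply: (@leq_trans (1 + L * j)%N).
    by rewrite (leq_trans _ (leq_addl _ _)) // leq_pmull.
  by rewrite -{1}[X in (X <= _)%N]expn1 leq_pexp2l.
case: (ex_maxnP P0 Pb) => j jN jmax.
set c := (1 + L * j)%N in jN *.
(* Modulo L, N - c^m is 2 m^m, half of L: in particular it is positive. *)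
have [q cq] := expn_1mod L j m.
rewrite -/c in cq.
have NE : N = (1 + 2 * m ^ m + k * L)%N by [].
have LE : L = (4 * m ^ m)%N by [].
have qk : (q <= k)%N by rewrite leqNgt; apply/negP => kq; nia.
have E : N = (m ^ m * (2 + 4 * (k - q)) + c ^ m)%N.
  by rewrite cq NE LE; have := subnK qk; nia.
exists (2 + 4 * (k - q))%N, c; split=> //.
- by rewrite addnC mulnC modnMDl.
- by rewrite /c oddD /= LE -mulnA oddM.
set t := (2 + 4 * (k - q))%N in E *.
have c0 : (0 < c)%N by rewrite /c.
have Nlt : (N < (c + L) ^ m)%N.
  rewrite ltnNge; apply/negP => H.
  have /jmax : ((1 + L * j.+1) ^ m <= N)%N by rewrite mulnS addnCA addnC.
  by rewrite ltnn.
have tA : (t <= m * L * (1 + L) ^ m.-1 * c ^ m.-1)%N.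
  rewrite -mulnA -expnMn.
  have H1 := expn_leq_secant c L m.
  have H2 : ((c + L) ^ m.-1 <= ((1 + L) * c) ^ m.-1)%N.
    by apply: leq_wexp2r; nia.
  have H3 : (m * L * (c + L) ^ m.-1 <= m * L * ((1 + L) * c) ^ m.-1)%N.
    by rewrite leq_mul2l H2 orbT.
  have : (t <= m ^ m * t)%N by rewrite leq_pmull.
  lia.
have -> : (N ^ m = N ^ m.-1 * N)%N by rewrite -expnSr prednK.
rewrite mulnA leq_mul2r; apply/orP; right.
apply: (@leq_trans ((m * L * (1 + L) ^ m.-1 * c ^ m.-1) ^ m)%N).
  exact: leq_wexp2r.
rewrite expnMn /height_const leq_mul2l -expnM mulnC expnM.
apply/orP; right.
by rewrite -expnM mulnC expnM leq_wexp2r.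
Qed.

(** * Squarefree integers in the residue class *)

Definition squarefree (N : nat) : bool :=
  all (fun d => ~~ (d ^ 2 %| N)%N) (iota 2 N).

Lemma squarefreeP (N d : nat) :
  (0 < N)%N -> squarefree N -> (1 < d)%N -> ~~ (d ^ 2 %| N)%N.
Proof.
move=> N0 /allP sqN d1; apply/negP => dN.
have dle : (d <= N)%N.
  have := dvdn_leq N0 dN; have := leq_pexp2l (ltnW d1) (leqnSn 1).
  by rewrite expn1; apply: leq_trans.
by have := sqN d; rewrite mem_iota d1 dN; lia.
Qed.

Lemma coprime_progression (m k : nat) : coprime (progression m k) (modulus m).
Proof.
apply: (@coprime_dvdr _ ((2 * m ^ m) ^ 2)%N).
  by apply/dvdnP; exists (m ^ m)%N; rewrite /modulus; ring.
apply: coprimeXr; rewrite coprime_sym /progression /modulus.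
have -> : (1 + 2 * m ^ m + k * (4 * m ^ m) = (1 + 2 * k) * (2 * m ^ m) + 1)%N.
  by ring.
by rewrite /coprime gcdnMDl gcdn1.
Qed.

(** If [q] divides two terms of the progression then it divides
[(i - j) * modulus m], hence [i - j], as the terms are prime to the modulus. So
every block of [q] consecutive indices contains at most one good index, and
[k %/ q] numbers the blocks. *)
Lemma count_progression_dvd (m q Y : nat) : (0 < q)%N ->
  (count (fun k => q %| progression m k) (iota 0 Y) <= Y %/ q + 1)%N.
Proof.
move=> q0; rewrite -size_filter -(size_map (fun k => k %/ q)%N).
rewrite -[leqRHS](size_iota 0); apply: uniq_leq_size.
  rewrite map_inj_in_uniq ?filter_uniq ?iota_uniq //.
  move=> i j; rewrite !mem_filter => /andP[qi _] /andP[qj _] ij.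
  wlog ji : i j qi qj ij / (j <= i)%N.
    by move=> W; case: (leqP i j) => [/W|/ltnW/W] => [-> //|->].
  have cop : coprime q (modulus m) := coprime_dvdl qi (coprime_progression m i).
  have : (q %| (i - j) * modulus m)%N.
    rewrite mulnBl -(subnDl (1 + 2 * m ^ m)) dvdn_sub //.
  rewrite Gauss_dvdl // => dij.
  have [ij0|ij0] := posnP (i - j)%N; first lia.
  have := dvdn_leq ij0 dij; have := divn_eq i q; have := divn_eq j q.
  by rewrite ij; have := ltn_pmod i q0; have := ltn_pmod j q0; lia.
move=> x /mapP[k]; rewrite mem_filter !mem_iota => /andP[_ /andP[_ kY]] ->.
by rewrite /= add0n addn1 ltnS leq_div2r // ltnW.
Qed.

(** A form without fractions of the telescoping estimate
[sum_(3 <= d < S + 3) 1 / d ^ 2 <= 1 / 2 - 1 / (S + 2)], whose right-hand side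
is [S / (2 * (S + 2))]. *)
Lemma sum_div_sqr (Y S : nat) :
  (2 * (S + 2) * \sum_(3 <= d < S + 3) Y %/ d ^ 2 <= Y * S)%N.
Proof.
elim: S => [|S IH]; first by rewrite big_geq.
rewrite (addSn S 3) big_nat_recr /=; last exact: leq_addl.
have := leq_divM Y ((S + 3) ^ 2).
move: IH; set s := bigop _ _ _; set x := (_ %/ _)%N => IH H.
have := leq_mul (leqnn (S + 3)) IH; have := leq_mul (leqnn (2 * (S + 2))) H.
rewrite -(@leq_pmul2l (S + 2)) ?addn2 //; nia.
Qed.

(** Discard the multiples of [d ^ 2] for [3 <= d]: this costs at most half of the
indices, plus one index for each [d] (from rounding). The lower bound on [Y]
ensures that [d ^ 2] exceeds every term as soon as [d] exceeds [Y / 4], so that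
the rounding errors cost at most another quarter. *)
Lemma count_squarefree (m Y : nat) : (16 * modulus m <= Y)%N ->
  (Y <= 4 * (count (fun k => squarefree (progression m k)) (iota 0 Y)).+1)%N.
Proof.
move=> LY; set good := fun k => squarefree _; set S := (Y %/ 4)%N.
have bad_le : (count (predC good) (iota 0 Y) <=
    \sum_(3 <= d < S + 3) count (fun k => d ^ 2 %| progression m k) (iota 0 Y))%N.
  under eq_bigr do rewrite -sum1_count big_mkcond.
  rewrite exchange_big /= -sum1_count big_mkcond /=.
  rewrite big_seq [leqRHS]big_seq; apply: leq_sum => k.
  rewrite mem_iota => /andP[_ kY].
  case: ifP => // /allPn[d]; rewrite mem_iota negbK => /andP[d2 dN] dk.
  have N0 : (0 < progression m k)%N by [].
  (* The terms are odd, so d = 2 cannot occur. *)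
  have d3 : (2 < d)%N.
    rewrite ltn_neqAle d2 andbT; apply/eqP => E; move: dk.
    by rewrite -E /progression /modulus => /dvdnP[r]; lia.
  have dS : (d < S + 3)%N.
    rewrite ltnNge; apply/negP => Sd.
    have := dvdn_leq N0 dk; rewrite /progression.
    have : (1 + 2 * m ^ m <= modulus m)%N.
      have : (0 < m ^ m)%N by rewrite expn_gt0; case: (m).
      by rewrite /modulus; lia.
    have := divn_eq Y 4; have := ltn_pmod Y (isT : 0 < 4)%N.
    by rewrite -/S; nia.
  rewrite (bigD1_seq d) /=; last 2 first.
  - by rewrite mem_index_iota d3.
  - by rewrite iota_uniq.
  by rewrite dk leq_addr.
have sum_le : (\sum_(3 <= d < S + 3) count (fun k => d ^ 2 %| progression m k)
    (iota 0 Y) <= \sum_(3 <= d < S + 3) (Y %/ d ^ 2) + S)%N.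
  apply: (@leq_trans (\sum_(3 <= d < S + 3) (Y %/ d ^ 2 + 1))%N); last first.
    by rewrite big_split /= sum_nat_const_nat addnK muln1.
  rewrite big_seq [leqRHS]big_seq; apply: leq_sum => d; rewrite mem_index_iota.
  by move=> /andP[d3 _]; apply: count_progression_dvd; rewrite expn_gt0; lia.
have := sum_div_sqr Y S; have := count_predC good (iota 0 Y).
rewrite size_iota; have := divn_eq Y 4; have := ltn_pmod Y (isT : 0 < 4)%N.
rewrite -/S; set s := (\sum_(_ <= d < _) Y %/ d ^ 2)%N in sum_le *.
nia.
Qed.

(** * Square classes of n N for squarefree N *)

Lemma Qadjoin_scale (z : algC) (e s : rat) : z ^+ 2 = ratr e -> s != 0 ->
  Qadjoin (ratr s * z) = Qadjoin z.
Proof.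
move=> z2 s0; rewrite (QadjoinE z e z2).
have sz2 : (ratr s * z) ^+ 2 = ratr (s ^+ 2 * e).
  by rewrite exprMn z2 rmorphM rmorphXn.
rewrite (QadjoinE _ _ sz2); apply/seteqP; split=> x /quad_spanP[u [v ->]];
  apply/quad_spanP.
  by exists u, (v * s); rewrite rmorphM mulrA.
by exists u, (v / s); rewrite mulrA -rmorphM /= divfK.
Qed.

(** The square of the denominator divides that of the numerator, hence so do the
numbers themselves. *)
Lemma nat_sqr_of_rat (w : rat) (x : nat) :
  w ^+ 2 = x%:R -> exists r, x = (r ^ 2)%N.
Proof.
move=> w2; have E : (`|numq w| ^ 2 = x * `|denq w| ^ 2)%N.
  have D0 : (denq w)%:~R != 0 :> rat by rewrite intr_eq0 denq_neq0.
  suff : numq w ^+ 2 = x%:Z * denq w ^+ 2.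
    by move/(congr1 absz); rewrite abszM !abszX.
  apply: (@intr_inj rat); rewrite [RHS]intrM !rmorphXn /= -pmulrn -w2 -exprMn.
  by congr (_ ^+ 2); apply: (canRL (divfK D0)); exact: divq_num_den.
have : (`|denq w| ^ 2 %| `|numq w| ^ 2)%N by rewrite E dvdn_mull.
rewrite dvdn_pexp2r // => /dvdnP[r rE]; exists r.
have D0 : (0 < `|denq w| ^ 2)%N by rewrite expn_gt0 absz_gt0 denq_neq0.
by apply/eqP; rewrite -(eqn_pmul2r D0) -E rE expnMn.
Qed.

(** With [N = N' * g], [r = r' * g] and [g = gcdn N r], the cofactor [N'] is prime
to [r'] and so divides [g]; then [N' ^ 2] divides [N] and [N' = 1]. *)
Lemma squarefree_dvd (N r : nat) :
  (0 < N)%N -> squarefree N -> (N %| r ^ 2)%N -> (N %| r)%N.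
Proof.
move=> N0 sqN Nr; have g0 : (0 < gcdn N r)%N by rewrite gcdn_gt0 N0.
have /dvdnP[N' NE] := dvdn_gcdl N r; have /dvdnP[r' rE] := dvdn_gcdr N r.
set g := gcdn N r in g0 NE rE.
have cop : coprime N' r'.
  by rewrite /coprime -(eqn_pmul2r g0) muln_gcdl -NE -rE mul1n.
have N'g : (N' %| g)%N.
  have : (N' * g %| g * r' ^ 2 * g)%N.
    by rewrite -NE (_ : g * r' ^ 2 * g = r ^ 2)%N // rE; ring.
  by rewrite dvdn_pmul2r // Gauss_dvdl // coprimeXr.
have N'1 : (N' <= 1)%N.
  rewrite leqNgt; apply/negP => /(squarefreeP N N' N0 sqN) /negP; apply.
  by rewrite NE expnS expn1 dvdn_mul.
have N'0 : N' = 1%N by move: N'1 N0; rewrite NE; case: (N') => [|[|]].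
by rewrite rE NE N'0 mul1n dvdn_mull.
Qed.

(** As [N] divides [r ^ 2] and is squarefree it divides [r], so [N ^ 2] divides
[n * N]. *)
Lemma squarefree_mul_sqr (N n r : nat) : (0 < N)%N -> squarefree N ->
  (n * N = r ^ 2)%N -> (N %| n)%N.
Proof.
move=> N0 sqN E; have /(squarefree_dvd N r N0 sqN) : (N %| r ^ 2)%N.
  by rewrite -E dvdn_mull.
move/(dvdn_exp2r 2); rewrite -E expnS expn1.
by rewrite dvdn_pmul2r.
Qed.

Definition twisted_field (n N : nat) : set algC :=
  Qadjoin (sqrtC (n * N)%:R).

Lemma sqrtC_nat_sqr (x : nat) : sqrtC (x%:R : algC) ^+ 2 = ratr x%:R.
Proof. by rewrite sqrtCK rmorph_nat. Qed.

Lemma mul_squarefree_nsqr (n N : nat) : (0 < n < N)%N -> squarefree N ->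
  forall w : rat, w ^+ 2 <> (n * N)%:R.
Proof.
move=> /andP[n0 nN] sqN w /nat_sqr_of_rat[r E].
have /dvdn_leq := squarefree_mul_sqr N n r (ltn_trans n0 nN) sqN E.
by rewrite n0 leqNgt nN => /(_ isT).
Qed.

Lemma twisted_field_inj (n N N' : nat) : (0 < n < N)%N -> (0 < N')%N ->
  squarefree N -> squarefree N' -> twisted_field n N = twisted_field n N' ->
  N = N'.
Proof.
move=> nN N'0 sqN sqN' /(Qadjoin_eq_sqr _ _ _ _ (sqrtC_nat_sqr _) (sqrtC_nat_sqr _)).
have /andP[n0 nltN] := nN; have N0 := ltn_trans n0 nltN.
case=> [|w]; first exact: mul_squarefree_nsqr nN sqN.
rewrite -natrM => /nat_sqr_of_rat[r E].
have {}E : (r ^ 2 = N * N' * n ^ 2)%N by rewrite -E; ring.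
have : (n ^ 2 %| r ^ 2)%N by rewrite E dvdn_mull.
rewrite dvdn_pexp2r // => /dvdnP[s rE].
have {}E : (N * N' = s ^ 2)%N.
  have n20 : (0 < n ^ 2)%N by rewrite expn_gt0 n0.
  by apply/eqP; rewrite -(eqn_pmul2r n20) -expnMn -rE E.
apply/eqP; rewrite eqn_dvd (squarefree_mul_sqr N N' s) //; last by rewrite mulnC.
by rewrite (squarefree_mul_sqr N' N s).
Qed.

(** * Fields produced by the trinomials *)

Lemma trinom_disc_nat (n a b : nat) :
  trinom_disc n a b = (n.-1 ^ n.-1 * a ^ n + n ^ n * b ^ n.-1)%N%:Z.
Proof.
have PX x k : (x ^ k)%N%:Z = x%:Z ^+ k by rewrite -natz natrX natz.
by rewrite /trinom_disc PoszD !PoszM !PX.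
Qed.

Lemma finite_disc_fields (R : realType) (n : nat) (D : R) :
  (2 <= n)%N -> finite_set (disc_fields n D).
Proof.
move=> n2; pose B := (Num.truncn D).+1.
apply: (@sub_finite_set _ _ ((fun ab : nat * nat =>
    Qadjoin (sqrtC (trinom_disc n ab.1 ab.2)%:~R)) @` (`I_B `*` `I_B))).
  move=> K [_ [a [b [a1 b1 _ discD ->]]]].
  case: a b a1 b1 discD => [a|//] [b|//] a1 b1; rewrite trinom_disc_nat => discD.
  set d := (X in Posz X) in discD.
  have dB : (d < B)%N.
    by rewrite ltnS truncn_ge_nat ?(le_trans _ discD) // ler0n.
  have n0 : (0 < n)%N by exact: ltnW.
  have a_le : (a <= a ^ n)%N by rewrite -{1}(expn1 a) leq_pexp2l.
  have b_le : (b <= b ^ n.-1)%N by rewrite -{1}(expn1 b) leq_pexp2l //; lia.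
  have m0 : (0 < n.-1 ^ n.-1)%N by rewrite expn_gt0; case: (n.-1).
  have nn0 : (0 < n ^ n)%N by rewrite expn_gt0 n0.
  exists (a, b); rewrite ?trinom_disc_nat //=; split;
    by apply: leq_ltn_trans dB; rewrite /d; nia.
by apply: finite_image; apply: finite_setX; apply: finite_II.
Qed.

(** With [a = n * t] and [b = t * c] the discriminant is
[n ^ n * t ^ n.-1 * N], which is [n * N] times the square of
[(n * t) ^ n.-1./2] because [n.-1] is even. *)
Lemma twisted_field_disc (R : realType) (n k : nat) (D : R) :
  (2 < n)%N -> odd n -> squarefree (progression n.-1 k) ->
  (n ^ n * height_const n.-1 * progression n.-1 k ^ n.-1)%:R <= D ->
  disc_fields n D (twisted_field n (progression n.-1 k)).
Proof.
move=> n3 nodd sqN HD; have n0 : (0 < n)%N by lia.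
have m0 : (0 < n.-1)%N by lia.
have [t [c [NE t4 codd tN]]] := progression_decomp n.-1 k m0.
have N0 : (0 < progression n.-1 k)%N by [].
have nN : (n < progression n.-1 k)%N.
  have : (n.-1 <= n.-1 ^ n.-1)%N by rewrite -{1}(expn1 n.-1) leq_pexp2l.
  by rewrite /progression; lia.
set N := progression n.-1 k in sqN HD NE tN N0 nN *.
have t0 : (0 < t)%N by case: t t4 {NE tN}.
have c0 : (0 < c)%N by case: c codd {NE tN}.
have dE : (n.-1 ^ n.-1 * (n * t) ^ n + n ^ n * (t * c) ^ n.-1
    = n ^ n * (t ^ n.-1 * N))%N.
  by rewrite NE !expnMn -{5}(prednK n0) [(t ^ _.+1)%N]expnS; ring.
pose s := ((n * t) ^ n.-1./2)%N.
have mE : (n.-1 = n.-1./2 * 2)%N by lia.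
have sE : (n ^ n * (t ^ n.-1 * N) = s ^ 2 * (n * N))%N.
  rewrite /s expnMn expnMn -!expnM -mE -{2}(prednK n0) expnS; ring.
have s0 : (0 < s)%N by rewrite expn_gt0 muln_gt0 n0 t0.
split.
  apply: Qadjoin_quadratic (sqrtC_nat_sqr _) _.
  by apply: mul_squarefree_nsqr => //; rewrite n0.
exists (n * t)%N, (t * c)%N; split.
- by rewrite lez_nat muln_gt0 n0.
- by rewrite lez_nat muln_gt0 t0.
- apply: (@irreducible_trinom 2) => //; first lia.
  + by rewrite dvdzE /= ; lia.
  + by rewrite dvdzE /= ; lia.
  + by rewrite dvdzE /= ; nia.
- rewrite trinom_disc_nat dE; apply: le_trans HD.
  rewrite gtr0_norm ?ltz_nat ?muln_gt0 ?expn_gt0 ?n0 ?t0 //.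
  by rewrite ler_nat -mulnA leq_mul2l tN orbT.
have sqE : sqrtC (s ^ 2 * (n * N))%:R = ratr s%:R * sqrtC (n * N)%:R :> algC.
  rewrite rmorph_nat (natrM _ (s ^ 2)) sqrtCM ?nnegrE ?ler0n //.
  by rewrite natrX sqrCK ?ler0n.
rewrite trinom_disc_nat dE sE /twisted_field -pmulrn.
by rewrite sqE (Qadjoin_scale _ _ _ (sqrtC_nat_sqr _)) // pnatr_eq0 -lt0n.
Qed.

(** * Counting the fields *)

Lemma Qcount_ge (R : realType) (n Y : nat) (D : R) :
  (2 < n)%N -> odd n -> (16 * modulus n.-1 <= Y)%N ->
  (n ^ n * height_const n.-1 * (modulus n.-1 * Y) ^ n.-1)%:R <= D ->
  (Y <= 4 * (Qcount n D).+1)%N.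
Proof.
move=> n3 nodd LY HD; apply: leq_trans (count_squarefree _ _ LY) _.
rewrite leq_mul2l ltnS /=; rewrite -size_filter.
set ks := seq.filter _ _; set F := fun k => twisted_field n (progression n.-1 k).
have M0 : (n.-1 <= n.-1 ^ n.-1)%N by rewrite -{1}(expn1 n.-1) leq_pexp2l; lia.
rewrite -(size_map F) /Qcount; apply: uniq_leq_size.
  rewrite map_inj_in_uniq ?filter_uniq ?iota_uniq // => i j.
  rewrite !mem_filter => /andP[sqi _] /andP[sqj _].
  move/(twisted_field_inj _ _ _ _ _ sqi sqj); rewrite /progression /modulus.
  by move=> H; have := H _ isT; nia.
move=> K /mapP[k]; rewrite mem_filter mem_iota => /andP[sqk /andP[_ kY]] ->.
rewrite in_fset_set; last by apply: finite_disc_fields; apply: ltnW.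
rewrite in_setE; apply: twisted_field_disc => //; apply: le_trans HD.
rewrite ler_nat leq_mul2l; apply/orP; right; apply: leq_wexp2r.
by rewrite /progression /modulus; nia.
Qed.

Theorem corollary1p7 (R : realType) (n : nat) (n_ge2 : (2 <= n)%N)
    (n_mod4 : n = 1 %[mod 4]) :
  exists eps : R -> R,
    eps D @[D --> +oo] --> (0 : R) /\
    \forall D \near +oo, D `^ ((n.-1)%:R^-1 + eps D) <= (Qcount n D)%:R.
Proof.
have n3 : (2 < n)%N by lia.
have nodd : odd n by lia.
set m := n.-1; set L := modulus m.
have m0 : (0 < m)%N by rewrite /m; lia.
have L0 : (0 < L)%N by rewrite /L /modulus muln_gt0 expn_gt0 m0.
pose C := (n ^ n * height_const m * L ^ m)%N.
have C0 : (0 < C)%N.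
  have n0 : (0 < n)%N by apply: ltnW.
  by rewrite /C /height_const -/L 2!muln_gt0 !expn_gt0 n0 L0 2!muln_gt0 m0 L0 expn_gt0.
have CR0 : 0 < C%:R :> R by rewrite ltr0n.
have mR0 : 0 < m%:R :> R by rewrite ltr0n.
(* The 16 absorbs the sieve and the rounding: x < Y + 1 <= 16 Qcount. *)
pose delta : R := (C%:R `^ m%:R^-1)^-1 / 16.
have d0 : 0 < delta by rewrite divr_gt0 // invr_gt0 powR_gt0.
exists (fun D => ln delta / ln D); split.
  apply/cvgr0Pnorm_lt => e e0.
  near=> D; have De : expR (`|ln delta| / e) < D.
    by near: D; apply: nbhs_pinfty_gt; exact: num_real.
  have lnD : `|ln delta| / e < ln D.
    by rewrite -[ltLHS]expRK ltr_ln ?posrE ?expR_gt0 ?(lt_trans (expR_gt0 _) De).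
  have ln0 : 0 < ln D by apply: le_lt_trans lnD; rewrite divr_ge0 // ltW.
  by rewrite normrM normfV (gtr0_norm ln0) ltr_pdivrMr // mulrC -ltr_pdivrMr.
near=> D.
have D1 : 1 < D by near: D; apply: nbhs_pinfty_gt; exact: num_real.
have D0 : 0 < D by apply: lt_trans D1.
have lnD0 : 0 < ln D by rewrite ln_gt0.
pose x := (D / C%:R) `^ m%:R^-1.
have x0 : 0 <= x by exact: powR_ge0.
have xm : x ^+ m = D / C%:R.
  rewrite -powR_mulrn // -powRrM mulVf ?gt_eqF // powRr1 //.
  by rewrite divr_ge0 // ltW.
pose Y := Num.truncn x.
have /andP[Yx xY] := truncn_itv x0.
have Ybig : (16 * L <= Y)%N.
  rewrite truncn_ge_nat // leNgt; apply/negP => xL.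
  have : x ^+ m < (16 * L)%:R ^+ m by rewrite ltrXn2r // -lt0n.
  rewrite xm ltr_pdivrMr // ltNge => /negP; apply; near: D.
  by apply: nbhs_pinfty_ge; exact: num_real.
(* Here 64 <= 16 * L <= Y, so the additive constants are absorbed. *)
have Q : (Y.+1 <= 16 * Qcount n D)%N.
  have : (Y <= 4 * (Qcount n D).+1)%N.
    apply: Qcount_ge => //.
    rewrite expnMn mulnA -/C natrM natrX mulrC -ler_pdivlMr // -xm.
    by rewrite lerXn2r // nnegrE ler0n.
  lia.
have -> : D `^ (m%:R^-1 + ln delta / ln D) = x / 16.
  rewrite powRD; last by rewrite (gt_eqF D0) implybT.
  have -> : D `^ (ln delta / ln D) = delta.
    by rewrite /powR gt_eqF // divfK ?gt_eqF // lnK.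
  rewrite /x powRM ?invr_ge0 ?ler0n ?(ltW D0) // /delta mulrA.
  by rewrite -powRN -mulN1r powRrM powR_inv1 // ltW.
rewrite ler_pdivrMr // -natrM mulnC; apply: le_trans (ltW xY) _.
by rewrite ler_nat.
Unshelve. all: by end_near.
Qed.
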